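(* Let $r\in[2,\infty)$, let $(X,\|\cdot\|)$ be an $r$-uniformly convex Banach space with constant $c_r$, and let $T:X\to X$ be a nonexpansive operator. If $T$ is quasi $\alpha$-firmly nonexpansive for some $\alpha\in(0,1)$, then, for any $x_0\in X$, all weak cluster points of the sequence of iterates $x_{n+1}:=Tx_n$, $n=0,1,2,\dots$, belong to $\mathrm{Fix}\,T$. If additionally the norm $\|\cdot\|$ is Fr\'echet differentiable, then these iterates converge weakly to an element of $\mathrm{Fix}\,T$.
   Context: For $r\in[2,\infty)$, a normed space $(X,\|\cdot\|)$ is called $r$-uniformly convex (with constant $c_r$) if there is a constant $c_r>0$ such that for all $w\in[0,1]$ and all $x,y\in X$ $$\|(1-w)x+wy\|^r\le(1-w)\|x\|^r+w\|y\|^r-\frac{c_r}{2}w(1-w)\|x-y\|^r.$$ The constant $c_r$ is fixed. Operators are maps $X\to X$, not necessarily linear; $\mathrm{Fix}\,T=\{x\in X:Tx=x\}$; $\mathrm{I}$ is the identity. $T$ is nonexpansive if $\|Tx-Ty\|\le\|x-y\|$ for all $x,y\in X$. For $\alpha\in(0,1)$, $T:X\to X$ is quasi $\alpha$-firmly nonexpansive if $\mathrm{Fix}\,T\ne\emptyset$ and for all $x\in X$ and all $y\in\mathrm{Fix}\,T$ $$\|Tx-Ty\|^r\le\|x-y\|^r-\frac{c_r}{2}\,\frac{1-\alpha}{\alpha}\,\|(\mathrm{I}-T)x-(\mathrm{I}-T)y\|^r.$$ A point $x\in X$ is a weak cluster point of a sequence $(x_n)$ if some subsequence of $(x_n)$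 converges weakly to $x$. The norm is Fr\'echet differentiable if it is Fr\'echet differentiable, as a function on $X$, at every $x\ne0$. *)

(* Defs.v *)
From HB Require Import structures.
From mathcomp Require Import all_boot all_order all_algebra.
From mathcomp Require Import all_classical all_reals all_analysis.

Set Implicit Arguments.
Unset Strict Implicit.
Unset Printing Implicit Defensive.

Import Order.TTheory GRing.Theory Num.Theory.
Import numFieldNormedType.Exports.

Local Open Scope classical_set_scope.
Local Open Scope ring_scope.

Definition uniformly_convex (R : realType) (X : normedModType R) (r c : R) : Prop :=
  0 < c /\
  forall (w : R) (x y : X), 0 <= w <= 1 ->
    `|(1 - w) *: x + w *: y| `^ r <=
      (1 - w) * `|x| `^ r + w * `|y| `^ r
      - c / 2 * w * (1 - w) * `|x - y| `^ r.

Definition Fix (X : Type) (T : X -> X) : set X := [set x | T x = x].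

Definition nonexpansive (R : realType) (X : normedModType R) (T : X -> X) : Prop :=
  forall x y : X, `|T x - T y| <= `|x - y|.

(* [c] is the constant of [r]-uniform convexity of [X]. *)
Definition quasi_firmly_nonexpansive (R : realType) (X : normedModType R)
    (r c alpha : R) (T : X -> X) : Prop :=
  Fix T !=set0 /\
  forall x y : X, Fix T y ->
    `|T x - T y| `^ r <=
      `|x - y| `^ r
      - c / 2 * ((1 - alpha) / alpha) * `|(x - T x) - (y - T y)| `^ r.

(* The topological dual of [X] consists of the continuous linear [f : X -> R^o]. *)
Definition weakly_converges (R : realType) (X : normedModType R)
    (u : nat -> X) (x : X) : Prop :=
  forall f : {linear X -> R^o}, continuous f -> f (u n) @[n --> \oo] --> f x.

(* [increasing_seq] is strict monotonicity, so [phi] extracts a subsequence. *)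
Definition weak_cluster_point (R : realType) (X : normedModType R)
    (u : nat -> X) (x : X) : Prop :=
  exists2 phi : nat -> nat, increasing_seq phi & weakly_converges (u \o phi) x.

(* [differentiable] is Frechet differentiability, with a continuous differential. *)
Definition frechet_differentiable_norm (R : realType) (X : normedModType R) : Prop :=
  forall x : X, x != 0 -> differentiable (fun z : X => `|z| : R^o) x.

Definition iterates (X : Type) (T : X -> X) (x0 : X) : nat -> X :=
  fun n => iter n T x0.

(* Main.v *)
Require Import Defs.
From HB Require Import structures.
From mathcomp Require Import all_boot all_order all_algebra.
From mathcomp Require Import all_classical all_reals all_analysis.
From mathcomp Require Import ring lra.

(** The iterates are Fejer monotone with respect to the fixed points, and the
quasi-firm inequality turns the convergence of the distances to one fixed point
into asymptotic regularity: [x n - T (x n)] tends to [0]. Everything else rests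
on one inequality, [nonexpansive_almost_affine]: in an [r]-uniformly convex
space a nonexpansive map is affine on the segment from [x] to [y] up to an error
controlled by the length that it loses on that segment.

First consequence: a segment between two approximate fixed points consists of
approximate fixed points. A convex combination of [y 0, y 1, ...] is built by
successive segments, so along a subsequence whose errors decrease fast enough
all convex combinations of a late tail are approximate fixed points
([fixed_points_of_tail_hulls]). A weak cluster point is a norm limit of such
combinations by the theorems of Hahn-Banach and Mazur, hence it is fixed
([demiclosed]).

For the weak convergence, the role of a weak cluster point of a subsequence is
played by a point common to the closed convex hulls of all its tails: nested
bounded convex sets in a complete uniformly convex space have a common closure
point ([nested_convex_closure]), and after passing to a further subsequence such
a point is fixed ([fixed_point_in_tail_hulls]). Let [p] be one obtained from the
whole sequence. If [f (x n)] did not tend to [f p], some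
subsequence would yield a fixed point [q] of this kind with [f q <> f p]. Now
Reich's argument applies. By the inequality above [|t x_n + (1 - t) p - q|]
converges for each [t]; differentiating the norm at [p - q], uniformly over the
bounded set of the [x_n - p], shows that [j (x n)] converges, where [j] is the
differential of the norm at [p - q]. Its limit must be [j p] as well as [j q], so
[|p - q| = j (p - q) = 0], a contradiction. *)

Import Order.TTheory GRing.Theory Num.Theory.
Import numFieldNormedType.Exports.

Local Open Scope classical_set_scope.
Local Open Scope ring_scope.

(** * Convex sets and hulls of tails of a sequence *)

Section convex_sets.
Context {R : realType} {E : lmodType R}.
Implicit Types C : set E.

(** Trades the weights of type [{i01 R}] for real numbers with bounds, on which
arithmetic is possible. *)
Lemma convex_setE C : convex_set (C : set (convex_lmodType E)) <->
  forall x y t, 0 <= t <= 1 -> C x -> C y -> C (t *: x + (1 - t) *: y).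
Proof.
split=> [cC x y t /andP[t0 t1] Cx Cy|cC x y t].
  have t01 : Itv.spec (@Itv.num_sem R) (Itv.Real `[0%Z, 1%Z]) t.
    by rewrite /= /Itv.num_sem num_real/= in_itv/= t0 t1.
  by have := cC x y (Itv.mk t01); rewrite !inE; apply.
by rewrite !inE => Cx Cy; apply: cC => //; rewrite ge0 le1.
Qed.

Lemma convex_set1 (a : E) :
  convex_set ([set a] : set (convex_lmodType E)).
Proof.
apply/convex_setE => _ _ t _ -> ->.
by rewrite -scalerDl addrC subrK scale1r.
Qed.

(** The union of the segments from [a] to the points of [C]. Iterating it yields
the convex combinations of finitely many points, in a form suited to induction. *)
Definition cone_from (a : E) C : set E :=
  [set z | exists (t : R) w, [/\ 0 <= t <= 1, C w & z = t *: a + (1 - t) *: w]].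

Lemma convex_cone_from a C : convex_set (C : set (convex_lmodType E)) ->
  convex_set (cone_from a C : set (convex_lmodType E)).
Proof.
move=> /convex_setE cC; apply/convex_setE.
move=> _ _ s /andP[s0 s1] [t [v [/andP[t0 t1] Cv ->]]]
  [t' [w [/andP[t'0 t'1] Cw ->]]].
pose l := s * (1 - t); pose m := (1 - s) * (1 - t').
have l0 : 0 <= l by rewrite mulr_ge0// subr_ge0.
have m0 : 0 <= m by rewrite mulr_ge0// subr_ge0.
have lm : s * t + (1 - s) * t' = 1 - (l + m) by rewrite /l /m; ring.
have lm1 : l + m <= 1 by rewrite /l /m; nra.
rewrite !scalerDr !scalerA addrACA -scalerDl lm -/l -/m.
have t01 : 0 <= 1 - (l + m) <= 1 by lra.
move: (l) (m) l0 m0 t01 {lm lm1} => {}l {}m l0 m0 t01.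
have [/eqP|lm0] := eqVneq (l + m) 0.
  rewrite paddr_eq0// => /andP[/eqP -> /eqP ->].
  exists 1, v; split => //; first by rewrite ler01 lexx.
  by rewrite addr0 subr0 subrr !scale0r addr0.
exists (1 - (l + m)), ((l / (l + m)) *: v + (1 - l / (l + m)) *: w); split => //.
  apply: cC => //; rewrite divr_ge0 ?addr_ge0//=.
  by rewrite ler_pdivrMr ?mul1r ?lerDl// lt_def lm0 addr_ge0.
rewrite subKr scalerDr !scalerA mulrBr mulr1 mulrCA divff// mulr1.
by rewrite (addrC l) addrK.
Qed.

Implicit Types y : nat -> E.

(** The convex hull of [y k], ..., [y (k + n)]. *)
Fixpoint hull y k n : set E :=
  if n is n'.+1 then cone_from (y k) (hull y k.+1 n') else [set y k].

Lemma hullS y k n : hull y k n `<=` hull y k n.+1.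
Proof.
elim: n k => [k _ ->|n IH k z [t [w [t01 yw ->]]]].
  exists 1, (y k.+1); split => //; first by rewrite ler01 lexx.
  by rewrite subrr scale0r addr0 scale1r.
by exists t, w; split => //; exact: IH.
Qed.

Lemma convex_hull y k n : convex_set (hull y k n : set (convex_lmodType E)).
Proof.
elim: n k => [k|n IH k]; first exact: convex_set1.
exact: convex_cone_from.
Qed.

Definition tail_hull y k : set E := \bigcup_n hull y k n.

Lemma hull_le y k m n : (m <= n)%N -> hull y k m `<=` hull y k n.
Proof.
elim: n => [|n IH]; first by rewrite leqn0 => /eqP ->.
rewrite leq_eqVlt => /predU1P[->//|]; rewrite ltnS => /IH mn.
by apply: subset_trans mn _; exact: hullS.
Qed.

Lemma convex_tail_hull y k : convex_set (tail_hull y k : set (convex_lmodType E)).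
Proof.
apply/convex_setE => v w t t01 [m _ ym] [n _ yn].
exists (maxn m n) => //; have /convex_setE := convex_hull y k (maxn m n).
apply=> //; first by apply: hull_le ym; exact: leq_maxl.
by apply: hull_le yn; exact: leq_maxr.
Qed.

Lemma tail_hullS y k : tail_hull y k.+1 `<=` tail_hull y k.
Proof.
move=> w [n _ yw]; exists n.+1 => //; exists 0, w; split => //.
  by rewrite lexx ler01.
by rewrite scale0r add0r subr0 scale1r.
Qed.

Lemma tail_hull_le y k l : (k <= l)%N -> tail_hull y l `<=` tail_hull y k.
Proof.
elim: l => [|l IH]; first by rewrite leqn0 => /eqP ->.
rewrite leq_eqVlt => /predU1P[->//|]; rewrite ltnS => /IH kl.
by apply: subset_trans kl; exact: tail_hullS.
Qed.

Lemma mem_tail_hull y k n : (k <= n)%N -> tail_hull y k (y n).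
Proof. by move=> kn; apply: tail_hull_le kn _ _; exists 0%N. Qed.

Lemma tail_hull_sub y k C : convex_set (C : set (convex_lmodType E)) ->
  (forall n, (k <= n)%N -> C (y n)) -> tail_hull y k `<=` C.
Proof.
move=> /convex_setE cC yC z [n _]; elim: n k yC z => [k yC z ->|n IH k yC z].
  exact: yC.
move=> [t [w [t01 yw ->]]]; apply: cC => //; first exact: yC.
by apply: IH yw => m /ltnW; exact: yC.
Qed.

End convex_sets.

Lemma convex_ball_le {R : realType} {X : normedModType R} (M : R) :
  convex_set ([set z : X | `|z| <= M] : set (convex_lmodType X)).
Proof.
apply/convex_setE => x y t /andP[t0 t1] /= xM yM.
apply: le_trans (ler_normD _ _) _; rewrite !normrZ !ger0_norm ?subr_ge0//.
have t1' : 0 <= 1 - t by rewrite subr_ge0.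
by have := ler_wpM2l t0 xM; have := ler_wpM2l t1' yM; lra.
Qed.

(** * The Hahn-Banach theorem *)

Section sublinear.
Context {R : realType} {X : lmodType R}.

(** Homogeneity is only required as an inequality, which is easier to check for
infima; equality follows, see [sublinearZ]. *)
Definition sublinear (p : X -> R) :=
  (forall x y, p (x + y) <= p x + p y) /\
  (forall a x, 0 <= a -> p (a *: x) <= a * p x).

Lemma sublinear0 p : sublinear p -> p 0 = 0.
Proof.
move=> [pD pZ]; apply/eqP; rewrite eq_le; apply/andP; split.
  by have := pZ 0 0 (lexx 0); rewrite scale0r mul0r.
by have := pD 0 0; rewrite addr0 lerDl.
Qed.

Lemma sublinearZ p a x : sublinear p -> 0 <= a -> p (a *: x) = a * p x.
Proof.
move=> sp; rewrite le_eqVlt => /predU1P[<-|a0].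
  by rewrite scale0r mul0r sublinear0.
have [_ pZ] := sp; apply/eqP; rewrite eq_le pZ ?(ltW a0)//=.
rewrite mulrC -ler_pdivlMr// mulrC -{1}(scalerK (lt0r_neq0 a0) x).
by rewrite pZ// invr_ge0 ltW.
Qed.

Lemma sublinear_opp_le p x : sublinear p -> - p (- x) <= p x.
Proof.
move=> sp; have [pD _] := sp; rewrite lerNl -subr_ge0 opprK addrC.
by rewrite -(sublinear0 _ sp) -(addrN x).
Qed.

(** Both constructions of smaller sublinear functions below are pointwise
infima; this isolates the closure conditions on the families that they need. *)
Lemma inf_sublinear (F : X -> set R) :
  (forall x, F x !=set0) -> (forall x, has_lbound (F x)) ->
  (forall x y u v, F x u -> F y v -> exists2 w, F (x + y) w & w <= u + v) ->
  (forall a x u, 0 <= a -> F x u -> exists2 w, F (a *: x) w & w <= a * u) ->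
  sublinear (inf \o F).
Proof.
move=> F0 Flb FD FZ; split=> [x y|a x].
  rewrite /= -lerBlDr; apply: lb_le_inf => // u Fu.
  rewrite lerBlDr -lerBlDl; apply: lb_le_inf => // v Fv.
  rewrite lerBlDl; have [w Fw] := FD _ _ _ _ Fu Fv.
  exact/le_trans/ge_inf.
rewrite le_eqVlt => /predU1P[<-|a0] /=.
  have [u Fu] := F0 x; rewrite mul0r.
  have [w Fw] := FZ _ _ _ (lexx 0) Fu; rewrite mul0r.
  exact/le_trans/ge_inf.
rewrite -ler_pdivrMl//; apply: lb_le_inf => // u Fu.
rewrite ler_pdivrMl//; have [w Fw] := FZ _ _ _ (ltW a0) Fu.
exact/le_trans/ge_inf.
Qed.

(** The function [Q x], infimum of [q (x + t *: k) - t * d] over [k] in [K] and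
[0 <= t], is a sublinear function below [q] which is at most [- d] on [- K]. For
[K = [set y]] and [d = q y] it shows that a minimal sublinear function is odd;
for [q] the norm and [K] a convex set at distance at least [d] from the origin it
produces the separating functional of Mazur's theorem. *)
Lemma sublinear_shift (q : X -> R) (K : set X) (d : R) :
  sublinear q -> K !=set0 -> convex_set (K : set (convex_lmodType X)) ->
  (forall k, K k -> d <= q k) ->
  exists Q, [/\ sublinear Q, forall x, Q x <= q x &
                forall k, K k -> Q (- k) <= - d].
Proof.
move=> sq [k0 Kk0] /convex_setE cK Kd; have [qD qZ] := sq.
pose F x := [set u | exists t k, [/\ 0 <= t, K k & u = q (x + t *: k) - t * d]].
have Flb x : has_lbound (F x).
  exists (- q (- x)) => _ [t [k [t0 Kk ->]]].
  have := qD (- x) (x + t *: k); rewrite addKr sublinearZ//.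
  by have := ler_wpM2l t0 (Kd _ Kk); lra.
exists (inf \o F); split.
- apply: inf_sublinear => //.
  + by move=> x; exists (q (x + 0 *: k0) - 0 * d), 0, k0.
  + move=> x y _ _ [s [k [s0 Kk ->]]] [t [l [t0 Kl ->]]].
    have [|st_neq0] := eqVneq (s + t) 0.
      move/eqP; rewrite paddr_eq0// => /andP[/eqP -> /eqP ->].
      exists (q (x + y)); last by rewrite !scale0r !addr0 !mul0r !subr0.
      by exists 0, k; rewrite scale0r addr0 mul0r subr0.
    exists (q (x + y + (s + t) *: ((s / (s + t)) *: k + (1 - s / (s + t)) *: l))
            - (s + t) * d).
      exists (s + t), ((s / (s + t)) *: k + (1 - s / (s + t)) *: l).
      split => //; first exact: addr_ge0.
      apply: cK => //; rewrite divr_ge0 ?addr_ge0//=.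
      by rewrite ler_pdivrMr ?mul1r ?lerDl// lt_def st_neq0 addr_ge0.
    rewrite scalerDr !scalerA mulrBr mulr1 mulrCA divff// mulr1 (addrC s) addrK.
    have := qD (x + s *: k) (y + t *: l); rewrite addrACA; lra.
  + move=> a x _ a0 [t [k [t0 Kk ->]]].
    exists (q (a *: x + (a * t) *: k) - (a * t) * d).
      by exists (a * t), k; split => //; exact: mulr_ge0.
    by rewrite -scalerA -scalerDr sublinearZ// mulrBr mulrA.
- move=> x; apply: ge_inf => //; exists 0, k0; split => //.
  by rewrite scale0r addr0 mul0r subr0.
- move=> k Kk; apply: ge_inf => //; exists 1, k; split => //.
  by rewrite scale1r addNr sublinear0// mul1r add0r.
Qed.

(** By Zorn's lemma there is a minimal sublinear function below [p]. Minimality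
against [sublinear_shift] makes it odd, and an odd sublinear function is
linear. *)
Theorem Hahn_Banach (p : X -> R) :
  sublinear p -> exists f : {linear X -> R^o}, forall x, f x <= p x.
Proof.
move=> sp.
pose S := {q : X -> R | sublinear q /\ forall x, q x <= p x}.
pose below (s t : S) := `[< forall x, sval t x <= sval s x >].
have pS : sublinear p /\ forall x, p x <= p x by split.
have [||A totA|[q [sq qp]] minq] := @ZL_preorder S (exist _ p pS) below.
- by move=> s; apply/asboolP.
- move=> r s t /asboolP rs /asboolP st; apply/asboolP => x.
  exact: le_trans (st x) (rs x).
- have [->|/set0P[s0 As0]] := eqVneq A set0; first by exists (exist _ p pS : S).
  pose F x := [set sval s x | s in A].
  have Flb x : has_lbound (F x).
    exists (- p (- x)) => _ [s As <-]; have [ss sp'] := svalP s.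
    by apply: le_trans (sublinear_opp_le _ _ ss); rewrite lerN2.
  have sF : sublinear (inf \o F).
    apply: inf_sublinear => //.
    + by move=> x; exists (sval s0 x), s0.
    + move=> x y _ _ [s As <-] [t At <-].
      have [/asboolP st|/asboolP ts] := totA _ _ As At.
        exists (sval t (x + y)); first by exists t.
        by apply: le_trans ((svalP t).1.1 _ _) _; rewrite lerD2r.
      exists (sval s (x + y)); first by exists s.
      by apply: le_trans ((svalP s).1.1 _ _) _; rewrite lerD2l.
    + move=> a x _ a0 [s As <-]; exists (sval s (a *: x)); first by exists s.
      exact: (svalP s).1.2.
  have Fp x : inf (F x) <= p x.
    by apply: le_trans ((svalP s0).2 x); apply: ge_inf => //; exists s0.
  exists (exist _ (inf \o F) (conj sF Fp) : S) => s As.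
  by apply/asboolP => x; apply: ge_inf => //; exists s.
have qN y : q (- y) = - q y.
  apply/eqP; rewrite eq_le; apply/andP; split; last first.
    by rewrite lerNl; exact: sublinear_opp_le.
  have [k ->//|Q [sQ Qq /(_ y erefl) Qy]] :=
    sublinear_shift q [set y] (q y) sq (ex_intro _ y erefl) (convex_set1 y).
  have Qp x : Q x <= p x := le_trans (Qq x) (qp x).
  have /asboolP /(_ (- y)) /= := minq (exist _ Q (conj sQ Qp) : S)
    (asboolT Qq).
  by move/le_trans; apply.
have [qD _] := sq.
have qlin : linear (q : X -> R^o).
  have qadd x y : q (x + y) = q x + q y.
    apply/eqP; rewrite eq_le qD/=.
    by have := qD (x + y) (- y); rewrite addrK qN; lra.
  move=> a x y; rewrite qadd; congr (_ + _).
  have [a0|a0] := leP 0 a; first exact: sublinearZ.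
  apply: oppr_inj; rewrite -qN -scaleNr sublinearZ ?oppr_ge0 ?ltW//.
  exact: mulNr.
pose f := HB.pack_for {linear X -> R^o} (q : X -> R^o)
  (GRing.isLinear.Build _ _ _ _ (q : X -> R^o) qlin).
by exists f.
Qed.

End sublinear.

(** * Weak limits and continuous functionals *)

Section weak_limits.
Context {R : realType} {X : normedModType R}.
Implicit Types (C : set X) (u : nat -> X).

Lemma closure_normP C x :
  closure C x <-> forall e, 0 < e -> exists2 y, C y & `|x - y| < e.
Proof.
split=> [Cx e e0|Cx B /nbhs_ballP[e /= e0 eB]].
  have [y [Cy]] := Cx _ (nbhsx_ballx x e e0).
  by rewrite -ball_normE; exists y.
have [y Cy xy] := Cx _ e0; exists y; split => //.
by apply: eB; rewrite -ball_normE.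
Qed.

(** Mazur's theorem. If [C] stays at distance [d] from [x], the norm can be
lowered to [- d] on the set of the [y - x], for [y] in [C]; a linear functional
below it is continuous and separates [x] from [C] by the gap [d]. *)
Lemma weak_limit_closure_convex C (u : nat -> X) x :
  convex_set (C : set (convex_lmodType X)) -> (forall n, C (u n)) ->
  weakly_converges u x -> closure C x.
Proof.
move=> cC Cu ux; apply/closure_normP => d d0; apply: contrapT => nC.
have Cd y : C y -> d <= `|x - y|.
  by move=> Cy; rewrite leNgt; apply/negP => xy; apply: nC; exists y.
pose K := [set x - y | y in C].
have [||||Q [sQ Qn QK]] :=
    sublinear_shift (fun z : X => `|z|) K d.
- split=> [|a z a0]; first exact: ler_normD.
  by rewrite normrZ ger0_norm.
- by exists (x - u 0%N), (u 0%N).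
- apply/convex_setE => _ _ t t01 [y Cy <-] [z Cz <-].
  exists (t *: y + (1 - t) *: z); first by move/convex_setE: cC; apply.
  by rewrite !scalerBr addrACA -scalerDl -opprD addrCA subrr addr0 scale1r.
- by move=> _ [y Cy <-]; exact: Cd.
have [f fQ] := Hahn_Banach Q sQ.
have fle z : `|f z| <= `|z|.
  rewrite ler_norml lerNl -raddfN; apply/andP; split.
    by rewrite -(normrN z); exact: le_trans (fQ _) (Qn _).
  exact: le_trans (fQ _) (Qn _).
have fc : continuous f.
  apply/linear_bounded_continuous/linear_boundedP.
  apply: filterS (nbhs_pinfty_ge (num_real 1)) => a a1 z.
  by apply: le_trans (fle z) _; rewrite ler_peMl.
have /cvgrPdist_lt /(_ d d0) [N _ /(_ N (leqnn N))] := ux f fc.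
apply/negP; rewrite -leNgt; apply: le_trans (ler_norm _).
have : f (u N - x) <= - d.
  by rewrite -opprB; apply: le_trans (fQ _) (QK _ _); exists (u N).
by rewrite raddfB/=; lra.
Qed.

Lemma weakly_converges_sub u x (phi : nat -> nat) :
  (forall k, (k <= phi k)%N) -> weakly_converges u x ->
  weakly_converges (u \o phi) x.
Proof.
move=> phi_ge ux f fc; apply: cvg_comp (ux f fc) => A [N _ NA].
by exists N => // k /= Nk; apply: NA => /=; exact: leq_trans (phi_ge k).
Qed.

(** Half-spaces are closed and convex, so an eventual bound on [f (u n)] passes
to the points in the closed hulls of the tails. *)
Lemma closure_tail_hull_le u k (f : {linear X -> R^o}) (b : R) p :
  continuous f -> (forall n, (k <= n)%N -> f (u n) <= b) ->
  closure (tail_hull u k) p -> f p <= b.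
Proof.
move=> fc fb /closure_normP pC; apply/ler_addgt0Pr => e e0.
have [K K0 fK] := linear_lipschitz fc.
have [z uz pz] := pC _ (divr_gt0 e0 K0).
have fz : f z <= b.
  suff /(_ z) : tail_hull u k `<=` [set z | f z <= b] by apply.
  apply: tail_hull_sub => // {pC uz pz}; apply/convex_setE.
  move=> x y t /andP[t0 t1] /= xb yb; rewrite linearD !linearZ/=.
  have t1' : 0 <= 1 - t by rewrite subr_ge0.
  have := ler_wpM2l t0 xb; have := ler_wpM2l t1' yb.
  by rewrite /GRing.scale/=; lra.
have := le_trans (ler_norm _) (fK (p - z)).
rewrite ltr_pdivlMr// mulrC in pz.
by rewrite raddfB/=; move: pz; move: (K * _) => *; lra.
Qed.

Lemma closure_tail_hull_ge u k (f : {linear X -> R^o}) (b : R) p :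
  continuous f -> (forall n, (k <= n)%N -> b <= f (u n)) ->
  closure (tail_hull u k) p -> b <= f p.
Proof.
move=> fc fb pC; rewrite -lerN2.
apply: (closure_tail_hull_le u k (\- f : {linear X -> R^o})) pC => [z|n kn].
  exact: cvgN (fc z).
by rewrite lerN2 fb.
Qed.

(** Hence a functional that converges along [u] takes its limit at each of the
generalized cluster points of [u]. *)
Lemma cvg_closure_tail_hull u (f : {linear X -> R^o}) (l : R) p :
  continuous f -> f (u n) @[n --> \oo] --> l ->
  (forall k, closure (tail_hull u k) p) -> f p = l.
Proof.
move=> fc ul pC; apply/eqP; rewrite eq_le; apply/andP; split.
  apply/ler_addgt0Pr => e e0.
  have /cvgrPdist_le /(_ _ e0) [N _ NP] := ul.
  apply: closure_tail_hull_le fc _ (pC N) => n Nn.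
  by have := NP n Nn; rewrite ler_norml => /andP[]; lra.
apply/ler_addgt0Pr => e e0; rewrite -lerBlDr.
have /cvgrPdist_le /(_ _ e0) [N _ NP] := ul.
apply: closure_tail_hull_ge fc _ (pC N) => n Nn.
by have := NP n Nn; rewrite ler_norml => /andP[]; lra.
Qed.

End weak_limits.

(** * Real powers *)

Lemma Bernoulli_subr {R : realDomainType} (l : R) n :
  0 <= l <= 1 -> 1 - n%:R * (1 - l) <= l ^+ n.
Proof.
move=> /andP[l0 l1]; elim: n => [|n IH]; first by rewrite mul0r subr0.
have [ln0 ln1] : 0 <= l ^+ n /\ l ^+ n <= 1 by rewrite exprn_ge0 ?exprn_ile1.
rewrite exprSr -natr1; nra.
Qed.

(** With [l = s / d] the difference is [d `^ r * (1 - l `^ r)]. Bounding [r] by a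
natural number [N] gives [l ^+ N <= l `^ r], and Bernoulli's inequality
concludes. *)
Lemma powR_lipschitz {R : realType} (r D : R) : 1 <= r ->
  exists2 L, 0 < L &
    forall s d, 0 <= s -> s <= d -> d <= D -> d `^ r - s `^ r <= L * (d - s).
Proof.
move=> r1; have r0 : 0 < r by lra.
have /ltW rN := archi_boundP (ltW r0); set N := Num.bound r in rN.
exists (N%:R * D `^ (r - 1) + 1).
  by rewrite ltr_wpDl// mulr_ge0// powR_ge0.
move=> s d s0 sd dD; have d0 : 0 <= d by lra.
apply: (@le_trans _ _ (N%:R * D `^ (r - 1) * (d - s))); last first.
  by rewrite ler_wpM2r ?subr_ge0// lerDl.
apply: (@le_trans _ _ (N%:R * d `^ (r - 1) * (d - s))); last first.
  rewrite ler_wpM2r ?subr_ge0// ler_wpM2l// ge0_ler_powR ?nnegrE ?subr_ge0//.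
  exact: (le_trans d0 dD).
move: d0; rewrite le_eqVlt => /predU1P[d_eq0|d_gt0].
  have -> : s = d by lra.
  by rewrite !subrr mulr0.
pose l := s / d; have sE : s = d * l by rewrite mulrC divfK ?gt_eqF.
have l0 : 0 <= l by rewrite divr_ge0// ltW.
have l1 : l <= 1 by rewrite ler_pdivrMr ?mul1r.
have l01 : 0 <= l <= 1 by rewrite l0 l1.
have lN : l ^+ N <= l `^ r.
  move: l0; rewrite le_eqVlt => /predU1P[<-|l_gt0].
    by rewrite expr0n powR0 ?gt_eqF.
  by rewrite -powR_mulrn ?(ltW l_gt0)// ger_powR ?l_gt0.
have q0 := powR_ge0 d (r - 1); have lB := Bernoulli_subr l N l01.
rewrite sE powRM ?(ltW d_gt0)// -(mulr_powRB1 (ltW d_gt0) r0).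
have lNr : 1 - l `^ r <= N%:R * (1 - l) by lra.
by have := ler_wpM2l (mulr_ge0 (ltW d_gt0) q0) lNr; lra.
Qed.

Lemma powR_le_inv {R : realType} (r a b : R) :
  0 < r -> 0 <= a -> 0 <= b -> a `^ r <= b `^ r -> a <= b.
Proof.
move=> r0 a0 b0; rewrite !leNgt; apply: contra => ba.
by rewrite gt0_ltr_powR ?nnegrE.
Qed.

(** * Nonexpansive maps on uniformly convex spaces *)

(** Put [z = t *: x + (1 - t) *: y]. The vectors [(S x - S z) / (1 - t)] and
[(S z - S y) / t] have norm at most [|x - y|] and average to [S x - S y]. If
[S x - S y] is nearly as long as [x - y], uniform convexity forces them to be
close to each other, and their difference is a multiple of the defect of affinity
of [S] at [z]. *)
Lemma nonexpansive_almost_affine {R : realType} {X : normedModType R} (r c : R)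
    (S : X -> X) x y (t : R) :
  1 <= r -> uniformly_convex X r c -> nonexpansive S -> 0 <= t <= 1 ->
  `|t *: S x + (1 - t) *: S y - S (t *: x + (1 - t) *: y)| `^ r
    <= 2 / c * (`|x - y| `^ r - `|S x - S y| `^ r).
Proof.
move=> r1 [c0 uc] neS /andP[t0 t1].
have r_gt0 : 0 < r := lt_le_trans ltr01 r1.
have r0 : 0 <= r := ltW r_gt0.
have rhs0 : 0 <= 2 / c * (`|x - y| `^ r - `|S x - S y| `^ r).
  rewrite mulr_ge0 ?divr_ge0 ?(ltW c0)// subr_ge0.
  by rewrite ge0_ler_powR ?nnegrE.
have r_neq0 : r != 0 by rewrite gt_eqF.
have [->|t_neq0] := eqVneq t 0.
  by rewrite !scale0r !add0r subr0 !scale1r subrr normr0 powR0.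
have [->|t_neq1] := eqVneq t 1.
  by rewrite subrr !scale0r !addr0 !scale1r subrr normr0 powR0.
have {t0 t_neq0} t0 : 0 < t by rewrite lt_def t_neq0.
have {t1 t_neq1} t1 : 0 < 1 - t by rewrite subr_gt0 lt_def eq_sym t_neq1.
set z := t *: x + (1 - t) *: y; set d := `|x - y|.
pose a := S x - S z; pose b := S z - S y.
have xz : x - z = (1 - t) *: (x - y).
  by rewrite /z scalerBr [in RHS]scalerBl scale1r opprD addrA.
have zy : z - y = t *: (x - y).
  by rewrite /z scalerBr scalerBl scale1r addrCA addrAC subrr add0r.
(* The two halves of the image, rescaled, are vectors of norm at most [d] whose
   barycenter is [S x - S y]: uniform convexity bounds their difference. *)
have na : `|(1 - t)^-1 *: a| `^ r <= d `^ r.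
  apply: ge0_ler_powR; rewrite ?nnegrE ?normr_ge0//.
  rewrite normrZ gtr0_norm ?invr_gt0// ler_pdivrMl//.
  by apply: le_trans (neS _ _) _; rewrite xz normrZ gtr0_norm.
have nb : `|t^-1 *: b| `^ r <= d `^ r.
  apply: ge0_ler_powR; rewrite ?nnegrE ?normr_ge0//.
  rewrite normrZ gtr0_norm ?invr_gt0// ler_pdivrMl//.
  by apply: le_trans (neS _ _) _; rewrite zy normrZ gtr0_norm.
have := uc t ((1 - t)^-1 *: a) (t^-1 *: b); rewrite (ltW t0) -subr_ge0 (ltW t1).
move=> /(_ isT); rewrite !scalerA !divff ?gt_eqF// !scale1r.
have -> : a + b = S x - S y by rewrite /a /b addrA subrK.
have -> : (1 - t)^-1 *: a - t^-1 *: b =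
    (t * (1 - t))^-1 *: (t *: S x + (1 - t) *: S y - S z).
  have <- : t *: a - (1 - t) *: b = t *: S x + (1 - t) *: S y - S z.
    rewrite /a /b !scalerBr opprB addrACA -opprD -scalerDl.
    by rewrite [t + _]addrC subrK scale1r.
  rewrite [in RHS]scalerBr !scalerA invfM mulrAC mulVf ?gt_eqF// mul1r.
  by rewrite -mulrA mulVf ?gt_eqF// mulr1.
set h := t *: S x + _ - _.
have g0 : 0 < t * (1 - t) by rewrite mulr_gt0.
have g1 : 1 <= (t * (1 - t))^-1 by rewrite invf_ge1//; nra.
(* Since [1 <= r], the factor [(t * (1 - t))^-1] leaves the power at the cost of
   its first power only, which the weight of uniform convexity absorbs. *)
have : (t * (1 - t))^-1 * `|h| `^ r <= `|(t * (1 - t))^-1 *: h| `^ r.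
  rewrite normrZ gtr0_norm ?invr_gt0// le1r_powRZ//; lra.
rewrite ler_pdivrMl// => hr uch.
rewrite -ler_pdivrMl ?divr_gt0// invf_div.
have c2 : 0 <= c / 2 by rewrite divr_ge0// ltW.
move: (ler_wpM2l c2 hr) (ler_wpM2l (ltW t1) na) (ler_wpM2l (ltW t0) nb) uch.
lra.
Qed.

(** The length lost by [T] on a segment between approximate fixed points is small,
so [T] is almost affine there and almost fixes the whole segment. The tolerance
[d] depends on the segment only through the bound [D] on its length. *)
Lemma almost_fixed_segment {R : realType} {X : normedModType R} (r c : R)
    (T : X -> X) (D e : R) :
  1 <= r -> uniformly_convex X r c -> nonexpansive T -> 0 < e ->
  exists2 d, 0 < d <= e & forall x y t, 0 <= t <= 1 -> `|x - y| <= D ->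
    `|x - T x| <= d -> `|y - T y| <= d ->
    let z := t *: x + (1 - t) *: y in `|z - T z| <= e.
Proof.
move=> r1 ucX neT e0; have [c0 _] := ucX.
have r0 : 0 < r := lt_le_trans ltr01 r1.
have [L L0 lipL] := powR_lipschitz r D r1.
pose b := (e / 2) `^ r * (c / (4 * L)).
have e2 : 0 < e / 2 by rewrite divr_gt0.
have b0 : 0 < b by rewrite mulr_gt0 ?powR_gt0// divr_gt0// mulr_gt0.
exists (Num.min (e / 2) b).
  by rewrite lt_min e2 b0 ge_min; apply/andP; split => //; apply/orP; left; lra.
move=> x y t t01 xyD; rewrite !le_min => /andP[xe xb] /andP[ye yb]; cbv zeta.
set z := t *: x + (1 - t) *: y.
have /andP[t0 t1] := t01.
set w := t *: T x + (1 - t) *: T y.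
have zw : `|z - w| <= e / 2.
  have -> : z - w = t *: (x - T x) + (1 - t) *: (y - T y).
    by rewrite /z /w opprD addrACA -!scalerBr.
  have t1' : 0 <= 1 - t by rewrite subr_ge0.
  apply: le_trans (ler_normD _ _) _; rewrite !normrZ !ger0_norm//.
  by have := ler_wpM2l t0 xe; have := ler_wpM2l t1' ye; lra.
suff wT : `|w - T z| <= e / 2.
  have -> : z - T z = (z - w) + (w - T z) by rewrite addrA subrK.
  by apply: le_trans (ler_normD _ _) _; lra.
apply: (@powR_le_inv _ r) => //; first exact: ltW.
apply: le_trans (nonexpansive_almost_affine r c T x y t r1 ucX neT t01) _.
(* [T] shortens the segment by at most the sum of the two displacements. *)
have Txy : `|x - y| - `|T x - T y| <= 2 * b.
  have -> : x - y = (x - T x) + (T x - T y) - (y - T y).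
    by rewrite opprB !addrA !subrK.
  have := ler_normB ((x - T x) + (T x - T y)) (y - T y).
  by have := ler_normD (x - T x) (T x - T y); lra.
have := lipL _ _ (normr_ge0 _) (neT x y) xyD.
have cL : 0 <= 2 / c by rewrite divr_ge0// ltW.
move=> /(ler_wpM2l cL) /le_trans; apply.
have := ler_wpM2l (ltW L0) Txy => /(ler_wpM2l cL) /le_trans; apply.
rewrite /b le_eqVlt; apply/orP; left; apply/eqP; field.
by rewrite !gt_eqF.
Qed.

(** Almost minimizers [z k] of the norm on [C k] form a Cauchy sequence: the
midpoint of [z k] and [z m] lies in [C k], so its norm is not much below the
infimum there, and uniform convexity bounds [z k - z m]. The infima increase to a
limit because the sets decrease and are bounded. *)
Lemma nested_convex_closure {R : realType} {X : completeNormedModType R}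
    (r c : R) (C : nat -> set X) (M : R) :
  1 <= r -> uniformly_convex X r c ->
  (forall k, C k !=set0) ->
  (forall k, convex_set (C k : set (convex_lmodType X))) ->
  (forall k l, (k <= l)%N -> C l `<=` C k) ->
  (forall z, C 0%N z -> `|z| <= M) ->
  exists p, forall k, closure (C k) p.
Proof.
move=> r1 [c0 uc] C0 cC Cle CM.
have r0 : 0 < r := lt_le_trans ltr01 r1.
pose F k := [set `|z| `^ r | z in C k].
have Flb k : has_lbound (F k) by exists 0 => _ [z _ <-]; exact: powR_ge0.
have F0 k : F k !=set0 by have [z Cz] := C0 k; exists (`|z| `^ r), z.
have Finf k : has_inf (F k) by [].
pose e k := inf (F k).
have e_nd : nondecreasing_seq e.
  move=> k l kl; apply: lb_le_inf => // _ [z Cz <-].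
  by apply: ge_inf => //; exists z => //; exact: Cle Cz.
have eM : has_ubound (range e).
  exists (M `^ r) => _ [k _ <-]; have [z Cz] := C0 k.
  have zM : `|z| <= M by apply: CM; exact: Cle Cz.
  apply: (@le_trans _ _ (`|z| `^ r)); first by apply: ge_inf => //; exists z.
  apply: ge0_ler_powR; rewrite ?nnegrE ?(ltW r0)//; exact: le_trans zM.
have /cvg_ex[/= l el] := nondecreasing_is_cvgn e_nd eM.
have el_le k : e k <= l.
  have := nondecreasing_cvgn_le e_nd (cvgP _ el) k.
  by move/cvg_lim : el => ->.
have /choice[z zP] : forall k, exists z, C k z /\ `|z| `^ r < e k + k.+1%:R^-1.
  move=> k; have [|_ [z Cz <-]] := inf_adherent _ (Finf k) (eps := k.+1%:R^-1).
    by rewrite invr_gt0.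
  by exists z.
have zkl k m : (k <= m)%N ->
    c / 8 * `|z k - z m| `^ r <= (l - e k) + k.+1%:R^-1.
  move=> km; have [Ck zk] := zP k; have [Cm zm] := zP m.
  have h2 : 0 <= (2^-1 : R) <= 1 by rewrite invr_ge0 ler0n invf_le1 ?ler1n.
  have := uc 2^-1 (z k) (z m) h2.
  have : e k <= `|(1 - 2^-1) *: z k + 2^-1 *: z m| `^ r.
    apply: ge_inf => //; exists ((1 - 2^-1) *: z k + 2^-1 *: z m) => //.
    rewrite addrC; have /convex_setE := cC k; apply => //.
    exact: Cle Cm.
  have mk : m.+1%:R^-1 <= k.+1%:R^-1 :> R.
    by rewrite lef_pV2 ?posrE// ler_nat ltnS.
  move: (el_le k) (el_le m) zk zm mk.
  move: (`|_ + _| `^ r) (`|z k| `^ r) (`|z m| `^ r) (`|z k - z m| `^ r).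
  move: (e k) (e m) (k.+1%:R^-1) (m.+1%:R^-1) => *.
  lra.
have zcauchy : cvg (z @ \oo).
  apply/cauchy_cvgP/cauchy_exP => d d0.
  have d0' : 0 < c / 8 * d `^ r by rewrite mulr_gt0 ?divr_gt0 ?powR_gt0.
  have : (l - e k) + k.+1%:R^-1 @[k --> \oo] --> (l - l) + 0.
    by apply: cvgD; [apply: cvgB => //; exact: cvg_cst|exact: cvg_harmonic].
  move=> /cvgrPdist_lt /(_ _ d0') [N _ /(_ N (leqnn N))].
  rewrite subrr addr0 sub0r normrN => /(le_lt_trans (ler_norm _)) NP.
  exists (z N), N => // m /= Nm; rewrite -ball_normE /=.
  rewrite ltNge; apply/negP => dle.
  have : d `^ r <= `|z N - z m| `^ r.
    by apply: ge0_ler_powR; rewrite ?nnegrE ?(ltW r0) ?(ltW d0).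
  have c8 : 0 <= c / 8 by rewrite divr_ge0// ltW.
  move=> /(ler_wpM2l c8) /le_trans /(_ (zkl N m Nm)) /le_lt_trans /(_ NP).
  by rewrite ltxx.
have /cvg_ex[/= p zp] := zcauchy; exists p => k; apply/closure_normP => d d0.
have /cvgrPdist_lt /(_ d d0) [N _ NP] := zp.
exists (z (maxn k N)); last by apply: NP => /=; exact: leq_maxr.
by apply: Cle (zP _).1; exact: leq_maxl.
Qed.

(** * Fixed points in the closed hulls of tails *)

(** The subsequence is chosen with errors [eps k] so fast decreasing that every
convex combination of [y k], [y k.+1], ... is fixed up to [eps k], by induction on
the number of points with [almost_fixed_segment]. *)
Lemma fixed_points_of_tail_hulls {R : realType} {X : normedModType R} (r c M : R)
    (T : X -> X) (u : nat -> X) :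
  1 <= r -> uniformly_convex X r c -> nonexpansive T ->
  (forall n, `|u n| <= M) -> u n - T (u n) @[n --> \oo] --> 0 ->
  exists2 phi : nat -> nat, (forall k, (k <= phi k)%N) &
    forall p, (forall k, closure (tail_hull (u \o phi) k) p) -> Fix T p.
Proof.
move=> r1 ucX neT uM uT.
have /choice[delta deltaP] : forall e, exists d, 0 < e -> 0 < d <= e /\
    forall x y t, 0 <= t <= 1 -> `|x - y| <= M + M ->
    `|x - T x| <= d -> `|y - T y| <= d ->
    let z := t *: x + (1 - t) *: y in `|z - T z| <= e.
  move=> e; have [e0|e0] := ltP 0 e; last by exists 0.
  by have [d] := almost_fixed_segment r c T (M + M) e r1 ucX neT e0; exists d.
(* If the tail from [k.+1] is fixed up to [eps k.+1], adding the point [y k] gives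
   hulls fixed up to [eps k]; the harmonic bound makes [eps] tend to [0]. *)
pose eps := fix eps k : R :=
  if k is k'.+1 then Num.min (delta (eps k')) k'.+1%:R^-1 else 1.
have eps_gt0 k : 0 < eps k.
  elim: k => [|k IH] /=; first exact: ltr01.
  by rewrite lt_min invr_gt0 ltr0n andbT; have [/andP[]] := deltaP _ IH.
have epsS k : eps k.+1 <= delta (eps k) by rewrite /= ge_min lexx.
have epsS_le k : eps k.+1 <= eps k.
  by apply: le_trans (epsS k) _; have [/andP[]] := deltaP _ (eps_gt0 k).
have /choice[N NP] : forall k, exists N, forall n, (N <= n)%N ->
    `|u n - T (u n)| <= eps k.+1.
  move=> k; have /cvgrPdist_le/(_ _ (eps_gt0 k.+1)) [N _ NP] := uT.
  by exists N => n Nn; have := NP n Nn; rewrite sub0r normrN.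
pose phi k := (k + N k)%N; exists phi => [k|p pC]; first exact: leq_addr.
pose y := u \o phi.
have yT k : `|y k - T (y k)| <= eps k.+1 by apply: NP; exact: leq_addl.
have hullM n k z : hull y k n z -> `|z| <= M.
  move=> yz; suff /(_ z) : tail_hull y k `<=` [set z | `|z| <= M].
    by apply; exists n.
  by apply: tail_hull_sub => [|m _]; [exact: convex_ball_le|exact: uM].
have hullT n k z : hull y k n z -> `|z - T z| <= eps k.
  elim: n k z => [k _ ->|n IH k z /=]; first exact: le_trans (yT k) (epsS_le k).
  move=> [t [w [t01 yw ->]]]; have [_] := deltaP _ (eps_gt0 k); apply=> //.
  - apply: le_trans (ler_normB _ _) _; apply: lerD; first exact: uM.
    exact: hullM yw.
  - exact: le_trans (yT k) (epsS k).
  - exact: le_trans (IH _ _ yw) (epsS k).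
have pT k : `|p - T p| <= eps k.
  apply/ler_addgt0Pr => d d0.
  have d2 : 0 < d / 2 by rewrite divr_gt0.
  have /closure_normP /(_ _ d2) [z [n _ yz] pz] := pC k.
  have -> : p - T p = (p - z) + (z - T z) + (T z - T p).
    by rewrite !addrA !subrK.
  have := ler_normD ((p - z) + (z - T z)) (T z - T p).
  have := ler_normD (p - z) (z - T z).
  by have := hullT _ _ _ yz; have := neT z p; rewrite (distrC z); lra.
apply/esym/eqP; rewrite -subr_eq0 -normr_eq0 eq_le normr_ge0 andbT.
apply/ler_addgt0Pr => d d0; rewrite add0r.
have := @cvg_harmonic R => /cvgrPdist_lt /(_ _ d0) [n _ /(_ n (leqnn n))].
rewrite sub0r normrN => /(le_lt_trans (ler_norm _)) /ltW; apply: le_trans.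
by apply: le_trans (pT n.+1) _; rewrite /= ge_min lexx orbT.
Qed.

(** The demiclosedness principle at the origin. A subsequence of [u] keeps the weak
limit [x], so by Mazur's theorem [x] is in the closed hulls of its tails. *)
Lemma demiclosed {R : realType} {X : normedModType R} (r c M : R)
    (T : X -> X) (u : nat -> X) x :
  1 <= r -> uniformly_convex X r c -> nonexpansive T ->
  (forall n, `|u n| <= M) -> u n - T (u n) @[n --> \oo] --> 0 ->
  weakly_converges u x -> Fix T x.
Proof.
move=> r1 ucX neT uM uT ux.
have [phi phi_ge] := fixed_points_of_tail_hulls r c M T u r1 ucX neT uM uT.
apply=> k; apply: (weak_limit_closure_convex _ (fun n => u (phi (k + n)%N))).
- exact: convex_tail_hull.
- by move=> n; apply: (mem_tail_hull (u \o phi)); exact: leq_addr.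
- apply: (weakly_converges_sub _ _ (fun n => phi (k + n)%N)) ux => n.
  exact: leq_trans (leq_addl _ _) (phi_ge _).
Qed.

(** A substitute for weak sequential compactness: [p] behaves like a weak cluster
point of [u]. *)
Lemma fixed_point_in_tail_hulls {R : realType} {X : completeNormedModType R}
    (r c M : R) (T : X -> X) (u : nat -> X) :
  1 <= r -> uniformly_convex X r c -> nonexpansive T ->
  (forall n, `|u n| <= M) -> u n - T (u n) @[n --> \oo] --> 0 ->
  exists (phi : nat -> nat) (p : X), [/\ forall k, (k <= phi k)%N, Fix T p &
    forall k, closure (tail_hull (u \o phi) k) p].
Proof.
move=> r1 ucX neT uM uT.
have [phi phi_ge phiT] := fixed_points_of_tail_hulls r c M T u r1 ucX neT uM uT.
have [|||z|p pC] :=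
    nested_convex_closure r c (tail_hull (u \o phi)) M r1 ucX.
- by move=> k; exists (u (phi k)); apply: (mem_tail_hull (u \o phi)).
- exact: convex_tail_hull.
- exact: tail_hull_le.
- suff : tail_hull (u \o phi) 0 `<=` [set z | `|z| <= M] by apply.
  by apply: tail_hull_sub => [|n _]; [exact: convex_ball_le|exact: uM].
- by exists phi, p; split => //; exact: phiT.
Qed.

(** * Iterates of a nonexpansive map *)

(** For [A] the tail from [N], the infimum of [A] is a lower bound of the later
terms, and one term near it bounds all its successors from above. *)
Lemma cvg_almost_nonincreasing {R : realType} (b : R^nat) (m : R) :
  (forall n, m <= b n) ->
  (forall e, 0 < e -> exists N, forall n k, (N <= n)%N -> b (n + k)%N <= b n + e) ->
  cvgn b.
Proof.
move=> bm be; apply/cauchy_cvgP/cauchy_exP => e e0.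
have e3 : 0 < e / 3 by rewrite divr_gt0.
have [N NP] := be _ e3.
pose A := [set b n | n in [set n | (N <= n)%N]].
have infA : has_inf A.
  split; first by exists (b N), N => //=.
  by exists m => _ [n _ <-].
have [_ [n Nn <-] bn] := inf_adherent e3 infA.
exists (inf A), n => // k /= nk; rewrite -ball_normE/= ltr_norml.
have := NP n (k - n)%N Nn; rewrite subnKC//.
have : inf A <= b k by apply: ge_inf; [case: infA|exists k => //=; exact: leq_trans nk].
by move=> *; apply/andP; split; lra.
Qed.

Section iterates.
Context {R : realType} {X : normedModType R} (r c : R) (T : X -> X) (x0 : X).
Hypotheses (r1 : 1 <= r) (ucX : uniformly_convex X r c) (neT : nonexpansive T).

Let r_gt0 : 0 < r := lt_le_trans ltr01 r1.
Local Notation x := (iterates T x0).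

Lemma nonexpansive_iter n : nonexpansive (iter n T).
Proof.
by elim: n => [//|n IH] y z; rewrite !iterS; apply: le_trans (neT _ _) (IH _ _).
Qed.

Lemma iter_fix p n : Fix T p -> iter n T p = p.
Proof. by move=> Tp; elim: n => //= n ->. Qed.

Lemma iteratesD n m : x (n + m)%N = iter m T (x n).
Proof. by rewrite /iterates addnC iterD. Qed.

Lemma nonincreasing_dist_fix p : Fix T p ->
  nonincreasing_seq (fun n => `|x n - p| `^ r).
Proof.
move=> Tp n m nm; rewrite -(subnKC nm) iteratesD.
apply: ge0_ler_powR; rewrite ?nnegrE ?(ltW r_gt0)//.
by rewrite -{1}(iter_fix p (m - n)%N Tp); exact: nonexpansive_iter.
Qed.

Lemma dist_fix_gap p e : Fix T p -> 0 < e ->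
  exists N, forall n k, (N <= n)%N ->
    `|x n - p| `^ r - `|x (n + k)%N - p| `^ r <= e.
Proof.
move=> Tp e0; pose a n := `|x n - p| `^ r.
have a_ni := nonincreasing_dist_fix p Tp.
have acv : cvgn a.
  apply: nonincreasing_is_cvgn a_ni _.
  by exists 0 => _ [n _ <-]; exact: powR_ge0.
have /cvgrPdist_le /(_ _ e0) [N _ NP] := acv.
exists N => n k Nn; have := NP n Nn; rewrite ler_norml => /andP[].
have : limn a <= a (n + k)%N := nonincreasing_cvgn_ge a_ni acv (n + k)%N.
by rewrite -/(a n) -/(a _); lra.
Qed.

Lemma iterates_bounded p : Fix T p -> exists2 M, 0 < M &
  forall n, `|x n - p| <= M /\ `|x n| <= M.
Proof.
move=> Tp; exists (`|x0 - p| + `|p| + 1) => [|n].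
  by have := normr_ge0 (x0 - p); have := normr_ge0 p; lra.
have d : `|x n - p| <= `|x0 - p|.
  rewrite -{1}(iter_fix p n Tp); exact: nonexpansive_iter.
have := ler_normD (x n - p) p; rewrite subrK.
by have := normr_ge0 p; have := normr_ge0 (x0 - p); split; lra.
Qed.

(** At a fixed point the quasi-firm inequality bounds [`|x n - T (x n)| `^ r] by a
multiple of a decrement of the convergent sequence [`|x n - p| `^ r]. *)
Lemma asymptotic_regularity alpha : 0 < alpha < 1 ->
  quasi_firmly_nonexpansive r c alpha T ->
  x n - T (x n) @[n --> \oo] --> 0.
Proof.
move=> /andP[a0 a1] [[p Tp] qT]; have [c0 _] := ucX.
pose K := c / 2 * ((1 - alpha) / alpha).
have K0 : 0 < K by rewrite mulr_gt0 ?divr_gt0// subr_gt0.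
apply/cvgrPdist_le => e e0.
have Ke : 0 < K * e `^ r by rewrite mulr_gt0 ?powR_gt0.
have [N NP] := dist_fix_gap p _ Tp Ke; exists N => // n /= Nn.
rewrite sub0r normrN; apply: (@powR_le_inv _ r) => //; first exact: ltW.
rewrite -(ler_pM2l K0); apply: le_trans (NP n 1%N Nn).
have := qT (x n) p Tp.
by rewrite addn1 /= Tp subrr subr0 -/K lerBrDr addrC -lerBrDr.
Qed.

(** The powers [iter k T] are nonexpansive and lose, on the segment from [x n] to
[p], a length which is small uniformly in [k]. They are thus almost affine there,
which makes the sequence almost nonincreasing. *)
Lemma cvg_norm_segment p q t : Fix T p -> Fix T q -> 0 <= t <= 1 ->
  cvgn (fun n => `|t *: x n + (1 - t) *: p - q|).
Proof.
move=> Tp Tq t01; have [c0 _] := ucX.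
apply: (cvg_almost_nonincreasing _ 0) => [n|e e0]; first exact: normr_ge0.
have ce : 0 < c / 2 * e `^ r by rewrite mulr_gt0 ?divr_gt0 ?powR_gt0.
have [N NP] := dist_fix_gap p _ Tp ce; exists N => n k Nn.
pose z := t *: x n + (1 - t) *: p.
have : `|t *: x (n + k)%N + (1 - t) *: p - iter k T z| <= e.
  apply: (@powR_le_inv _ r) => //; first exact: ltW.
  have := nonexpansive_almost_affine r c (iter k T) (x n) p t
    r1 ucX (nonexpansive_iter k) t01.
  rewrite -iteratesD iter_fix// => /le_trans; apply.
  by rewrite -ler_pdivlMl ?divr_gt0// invf_div; exact: NP.
have : `|iter k T z - q| <= `|z - q|.
  by rewrite -{1}(iter_fix q k Tq); exact: nonexpansive_iter.
have := ler_normD (t *: x (n + k)%N + (1 - t) *: p - iter k T z) (iter k T z - q).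
by rewrite addrA subrK -/z; lra.
Qed.

End iterates.

(** * The differential of the norm along the iterates *)

Section norm_differential.
Context {R : realType} {X : normedModType R} (e : X).
Hypothesis diffe : differentiable (fun z : X => `|z| : R^o) e.

Let j : {linear X -> R^o} := 'd (fun z : X => `|z| : R^o) e.

Lemma norm_expansion eps : 0 < eps -> exists2 d, 0 < d &
  forall h, `|h| <= d -> `| `|e + h| - `|e| - j h| <= eps * `|h|.
Proof.
move=> eps0; have [_ /eqaddoP/(_ _ eps0)] := iffLR (diff_locallyP _ _) diffe.
move=> /nbhs_normP[d /= d0 dP]; exists (d / 2) => [|h hd]; first by rewrite divr_gt0.
have := dP h; rewrite /= sub0r normrN (addrC e) -addrA -opprD; apply.
by apply: le_lt_trans hd _; rewrite ltr_pdivrMr// ltr_pMr// ltr1n.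
Qed.

(** Follows from expanding the norm along the ray spanned by [e]. *)
Lemma norm_differential_self : e != 0 -> j e = `|e|.
Proof.
move=> e_neq0; have ne0 : 0 < `|e| by rewrite normr_gt0.
apply/eqP; rewrite eq_sym -subr_eq0 -normr_eq0 eq_le normr_ge0 andbT.
apply/ler_addgt0Pr => eps eps0; rewrite add0r.
have [d d0 dP] := norm_expansion _ (divr_gt0 eps0 ne0).
pose s := d / `|e|; have s0 : 0 < s by rewrite divr_gt0.
have := dP (s *: e); rewrite normrZ gtr0_norm// divfK ?gt_eqF// => /(_ (lexx _)).
have -> : e + s *: e = (1 + s) *: e by rewrite scalerDl scale1r.
rewrite normrZ gtr0_norm ?addr_gt0// linearZ/=.
have -> : (1 + s) * `|e| - `|e| - s *: (j e : R^o) = s * (`|e| - j e).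
  by rewrite /GRing.scale/=; ring.
rewrite normrM gtr0_norm// -ler_pdivlMl// => /le_trans; apply.
by rewrite le_eqVlt; apply/orP; left; apply/eqP; rewrite /s; field; rewrite !gt_eqF.
Qed.

End norm_differential.

(** Reich's lemma. The difference quotient of the norm at [p - q] in the direction
[x n - p] converges as [n] grows, by [cvg_norm_segment], and it approximates
[j (x n - p)] uniformly in [n] because the iterates are bounded; so [j (x n)] is a
Cauchy sequence. *)
Lemma cvg_norm_differential {R : realType} {X : normedModType R} (r c : R)
    (T : X -> X) (x0 p q : X) :
  1 <= r -> uniformly_convex X r c -> nonexpansive T -> Fix T p -> Fix T q ->
  differentiable (fun z : X => `|z| : R^o) (p - q) ->
  cvgn (fun n => 'd (fun z : X => `|z| : R^o) (p - q) (iterates T x0 n)).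
Proof.
move=> r1 ucX neT Tp Tq dpq; set j := 'd _ _; pose x := iterates T x0.
have [M M0 xM] := iterates_bounded T x0 neT p Tp.
apply/cauchy_cvgP/cauchy_exP => e e0.
have eM : 0 < e / (2 * M) by rewrite divr_gt0// mulr_gt0.
have [d d0 dP] := norm_expansion (p - q) dpq _ eM.
(* A step [t] for which the differential approximates the difference quotient
   of the norm at [p - q] in all the bounded directions [x n - p] at once. *)
pose t := Num.min 1 (d / M).
have t0 : 0 < t by rewrite lt_min ltr01 divr_gt0.
have t1 : t <= 1 by rewrite ge_min lexx.
have tM : t * M <= d by rewrite -ler_pdivlMr// ge_min lexx orbT.
have t01 : 0 <= t <= 1 by rewrite ltW.
have /cvg_ex[/= B bB] := cvg_norm_segment r c T x0 r1 ucX neT p q t Tp Tq t01.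
have te : 0 < t * (e / 2) by rewrite mulr_gt0 ?divr_gt0.
have /cvgrPdist_lt /(_ _ te) [N _ NP] := bB.
(* The quotients converge to [(B - `|p - q|) / t]. *)
exists ((B - `|p - q|) / t + j p), N => // n /= Nn; rewrite -ball_normE /=.
have := NP n Nn; have [xnM _] := xM n.
have txM : `|t *: (x n - p)| = t * `|x n - p| by rewrite normrZ gtr0_norm.
have /dP : `|t *: (x n - p)| <= d.
  by rewrite txM; apply: le_trans tM; rewrite ler_pM2l.
have -> : p - q + t *: (x n - p) = t *: x n + (1 - t) *: p - q.
  by rewrite scalerBl scalerBr scale1r addrAC addrCA.
rewrite txM linearZ/= linearB/= /GRing.scale/=.
set A := `|t *: x n + _ - q|; set E := `|p - q| => jA BA.
have -> : (B - E) / t + j p - j (iterates T x0 n) =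
    t^-1 * ((B - A) + (A - E - t * (j (x n) - j p))).
  by rewrite /x; field; rewrite gt_eqF.
rewrite normrM gtr0_norm ?invr_gt0// ltr_pdivrMl//.
apply: le_lt_trans (ler_normD _ _) _.
have : e / (2 * M) * (t * `|x n - p|) <= t * (e / 2).
  apply: (@le_trans _ _ (e / (2 * M) * (t * M))).
    by rewrite ler_pM2l// ler_pM2l.
  by rewrite le_eqVlt; apply/orP; left; apply/eqP; field; rewrite gt_eqF.
by move: jA BA; move: (`|_|) (`|_|) (e / _ * _) => *; lra.
Qed.

(** * Weak convergence of the iterates *)

Theorem corollary5p8 (R : realType) (X : completeNormedModType R) (r c : R)
    (T : X -> X)
    (hr : 2 <= r)
    (hX : uniformly_convex X r c)
    (hT : nonexpansive T)
    (hqT : exists2 alpha : R,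
        0 < alpha < 1 & quasi_firmly_nonexpansive r c alpha T) :
  (forall x0 x : X, weak_cluster_point (iterates T x0) x -> Fix T x) /\
  (frechet_differentiable_norm X ->
   forall x0 : X, exists2 p : X, Fix T p & weakly_converges (iterates T x0) p).
Proof.
have r1 : 1 <= r by apply: le_trans hr; rewrite ler1n.
have [alpha a01 qT] := hqT; have [[q0 Tq0] _] := qT.
have regular x0 := asymptotic_regularity r c T x0 r1 hX hT alpha a01 qT.
have regular_sub x0 (phi : nat -> nat) : (forall k, (k <= phi k)%N) ->
    iterates T x0 (phi n) - T (iterates T x0 (phi n)) @[n --> \oo] --> 0.
  move=> phi_ge; apply: cvg_comp (regular x0) => A [N _ NA].
  by exists N => // k /= Nk; apply: NA => /=; exact: leq_trans (phi_ge k).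
have bounded x0 := iterates_bounded T x0 hT q0 Tq0.
split=> [x0 x [phi phi_mono phix]|smooth x0].
  have [M _ xM] := bounded x0.
  apply: (demiclosed r c M T _ x r1 hX hT _ _ phix) => [n|].
    exact: (xM _).2.
  apply: regular_sub => k; elim: k => // k /leq_ltn_trans; apply.
  by rewrite ltnNge -leEnat phi_mono -ltnNge.
pose x := iterates T x0.
have [M _ xM] := bounded x0.
have xM' n : `|x n| <= M := (xM n).2.
have [phi [p [phi_ge Tp pC]]] :=
  fixed_point_in_tail_hulls r c M T x r1 hX hT xM' (regular x0).
exists p => // f fc.
(* One-sided estimates suffice, as they also apply to the opposite functional. *)
have upper (g : {linear X -> R^o}) : continuous g -> forall e, 0 < e ->
    exists N, forall n, (N <= n)%N -> g (x n) < g p + e.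
  move=> gc e e0; apply: contrapT => /forallNP nN.
  have /choice[psi psiP] : forall N, exists n, (N <= n)%N /\ g p + e <= g (x n).
    move=> N; have /existsNP[n /not_implyP[Nn /negP]] := nN N.
    by rewrite -leNgt => gn; exists n.
  have psi_ge k := (psiP k).1; have psi_g k := (psiP k).2.
  have [phi' [q [phi'_ge Tq qC]]] :=
    fixed_point_in_tail_hulls r c M T (x \o psi) r1 hX hT
      (fun n => xM' (psi n)) (regular_sub x0 psi psi_ge).
  have gq : g p + e <= g q.
    by apply: closure_tail_hull_ge gc _ (qC 0%N) => n _; exact: psi_g.
  have pq : p - q != 0.
    by apply/negP; rewrite subr_eq0 => /eqP pq; move: gq; rewrite pq; lra.
  have /cvg_ex[/= l jl] :=
    cvg_norm_differential r c T x0 p q r1 hX hT Tp Tq (smooth _ pq).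
  (* Both [p] and [q] are in the closed hulls of all tails of a subsequence of
     [x], along which the differential still tends to [l]. *)
  have limit_eq (theta : nat -> nat) z : (forall k, (k <= theta k)%N) ->
      (forall k, closure (tail_hull (x \o theta) k) z) ->
      'd (fun z : X => `|z| : R^o) (p - q) z = l.
    move=> theta_ge; apply: cvg_closure_tail_hull => //.
      exact: diff_continuous (smooth _ pq).
    apply: cvg_comp jl => A [N _ NA]; exists N => // k /= Nk.
    by apply: NA => /=; exact: leq_trans (theta_ge k).
  have := norm_differential_self (p - q) (smooth _ pq) pq.
  rewrite linearB/= (limit_eq phi p)// (limit_eq (psi \o phi') q)//; last first.
    by move=> k; exact: leq_trans (phi'_ge k) (psi_ge _).
  by move/eqP; rewrite subrr eq_sym normr_eq0 (negbTE pq).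
apply/cvgrPdist_lt => e e0.
have [N NP] := upper f fc e e0.
have fNc : continuous (\- f : {linear X -> R^o}) by move=> z; exact: cvgN (fc z).
have [N' NP'] := upper _ fNc e e0.
exists (maxn N N') => // n /=; rewrite geq_max => /andP[Nn N'n].
have := NP n Nn; have := NP' n N'n; rewrite /= ltr_norml => lo up.
by apply/andP; split; lra.
Qed.
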